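(* Let $\hat\Delta=\{\alpha(0),\alpha(1),\dots,\alpha(n)\}\subset(2\mathbb{N})^n$ be such that $\Delta=\operatorname{conv}(\hat\Delta)$ is an $n$-dimensional lattice simplex in $\mathbb{R}^n$. Let $B=\frac12\Delta\cap\mathbb{N}^n$ and let $I_B$ be the corresponding toric ideal of $B$. If (1) $I_B$ is generated in degree two, i.e. $I_B=\langle I_{B,2}\rangle$, and (2) the simplex $\frac12\Delta$ is $2$-normal, then $\Delta$ is an $H$-simplex.
   Context: $\mathbb{N}=\{0,1,2,\dots\}$. The toric ideal $I_B$ of the finite point configuration $B\subset\mathbb{N}^n$ is the (homogeneous) kernel of the ring homomorphism $k[x_b: b\in B]\to k[s,t_1,\dots,t_n]$, $x_b\mapsto s\,t^b$ ($k$ a field); it is generated by the binomials $x^m-x^{m'}$ with $m,m'\in\mathbb{N}^B$, $|m|=|m'|$ and $\sum_b m_b b=\sum_b m'_b b$. $I_{B,2}$ denotes its homogeneous part of degree two. A full-dimensional lattice polytope $P\subset\mathbb{R}^n$ is $k$-normal if every lattice point of $kP$ is a sum of exactly $k$ lattice points of $P$. Mediated sets: for $L\subseteq\Delta\cap\mathbb{Z}^n$ put $\overline{A}(L)=\{\tfrac12(s+t)\in\mathbb{Z}^n: s\ne t,\ s,t\in L\cap(2\mathbb{Z})^n\}$. $L$ is $\hat\Delta$-mediated if $\hat\Delta\subseteq L\subseteq\overline{A}(L)\cup\hat\Delta$. $\Delta^*$ denotes the (unique) maximal $\hat\Delta$-mediated set, which contains every $\hat\Delta$-mediated set. $\Delta$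 is an $H$-simplex if $\Delta^*=\Delta\cap\mathbb{Z}^n$, i.e. every lattice point of $\Delta$ other than the vertices is the midpoint of two distinct even lattice points of $\Delta$. *)

(* Defs.v *)
From mathcomp Require Import all_boot all_order all_algebra.
From mathcomp Require Import mpoly finmap boolp classical_sets cardinality reals.

Set Implicit Arguments.
Unset Strict Implicit.
Unset Printing Implicit Defensive.

Import Order.TTheory GRing.Theory Num.Theory.

Local Open Scope classical_set_scope.
Local Open Scope ring_scope.

Section Geometry.
Variables (R : realType) (n : nat).
Implicit Types (S L : set 'rV[R]_n).

Definition conv m (p : 'I_m -> 'rV[R]_n) : set 'rV[R]_n :=
  [set x | exists c : 'I_m -> R,
     [/\ forall i, 0 <= c i, \sum_i c i = 1 & x = \sum_i c i *: p i]].

Definition affinely_independent m (p : 'I_m -> 'rV[R]_n) : Prop :=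
  forall c : 'I_m -> R,
    \sum_i c i = 0 -> \sum_i c i *: p i = 0 -> forall i, c i = 0.

Definition dilate (c : R) S : set 'rV[R]_n := [set c *: x | x in S].

Definition Zlattice : set 'rV[R]_n :=
  [set x | forall j, exists z : int, x 0 j = z%:~R].

Definition even_lattice : set 'rV[R]_n :=
  [set x | forall j, exists z : int, x 0 j = (2 * z)%:~R].

Definition normal_polytope (k : nat) (P : set 'rV[R]_n) : Prop :=
  forall x, (dilate k%:R P `&` Zlattice) x ->
    exists2 y : 'I_k -> 'rV[R]_n,
      forall i, (P `&` Zlattice) (y i) & x = \sum_i y i.

(* P `&` N^n, each point being recorded as an exponent vector; fset_set returns
   fset0 on infinite sets, see nat_points_finite below *)
Definition exponent_point (b : 'X_{1..n}) : 'rV[R]_n := \row_j (b j)%:R.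

Definition nat_points (P : set 'rV[R]_n) : {fset 'X_{1..n}} :=
  fset_set [set b | P (exponent_point b)].

Definition midpoints L : set 'rV[R]_n :=
  [set x | Zlattice x /\ exists s t, [/\ s != t, (L `&` even_lattice) s,
     (L `&` even_lattice) t & x = 2^-1 *: (s + t)]].

Definition mediated m (a : 'I_m -> 'rV[R]_n) L : Prop :=
  [/\ L `<=` conv a `&` Zlattice,
      range a `<=` L & L `<=` midpoints L `|` range a].

Definition max_mediated m (a : 'I_m -> 'rV[R]_n) : set 'rV[R]_n :=
  \bigcup_(L in mediated a) L.

Definition H_simplex m (a : 'I_m -> 'rV[R]_n) : Prop :=
  max_mediated a = conv a `&` Zlattice.

End Geometry.

Definition ideal_span (A : comNzRingType) (S : set A) : set A :=
  [set f | exists s : seq (A * A),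
     (forall gh, gh \in s -> S gh.2) /\ f = \sum_(gh <- s) gh.1 * gh.2].

Section Toric.
Variables (k : fieldType) (n : nat) (B : {fset 'X_{1..n}}).

(* the variables x_b are indexed by the positions in the enumeration of B; in
   k[s, t_1, ..., t_n] the variable number 0 is s *)
Definition toric_monomial (b : 'X_{1..n}) : {mpoly k[n.+1]} :=
  'X_ord0 * \prod_(j < n) 'X_(lift ord0 j) ^+ b j.

Definition toric_map (f : {mpoly k[#|` B|]}) : {mpoly k[n.+1]} :=
  mmap (@mpolyC n.+1 k) (fun i => toric_monomial (tnth (in_tuple B) i)) f.

Definition toric_ideal : set {mpoly k[#|` B|]} := [set f | toric_map f = 0].

Definition toric_ideal_part (d : nat) : set {mpoly k[#|` B|]} :=
  [set f | toric_ideal f /\ f \is d.-homog].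

Definition generated_in_degree (d : nat) : Prop :=
  toric_ideal = ideal_span (toric_ideal_part d).

End Toric.

Lemma nat_points_finite (R : realType) n m (c : R) (p : 'I_m -> 'rV[R]_n) :
  finite_set [set b : 'X_{1..n} | dilate c (conv p) (exponent_point R b)].
Proof.
pose M := \sum_i \sum_j `|c * p i 0 j|.
have M0 : 0 <= M by apply: sumr_ge0 => i _; apply: sumr_ge0.
pose N := Num.bound M.
pose g (f : {ffun 'I_n -> 'I_N.+1}) : 'X_{1..n} := [multinom (f j : nat) | j < n].
apply: (@sub_finite_set _ _ (g @` setT)); last first.
  by apply: finite_image; exact: finite_finset.
move=> b /= [x [w [w0 w1 ->]] e].
have bN j : (b j < N.+1)%N.
  have /rowP/(_ j) := e; rewrite !mxE summxE mulr_sumr => ebj.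
  have bM : (b j)%:R <= M.
    rewrite -ebj; apply: ler_sum => i _; rewrite !mxE mulrCA.
    apply: (@le_trans _ _ `|c * p i 0 j|).
      have wi1 : w i <= 1 by rewrite -w1 (bigD1 i) //= lerDl sumr_ge0.
      apply: (le_trans (ler_norm _)); rewrite normrM ger0_norm //.
      by rewrite ler_piMl.
    by rewrite (bigD1 j) //= lerDl sumr_ge0.
  have := le_lt_trans bM (archi_boundP M0); rewrite ltr_nat => /ltnW; exact.
exists [ffun j => Ordinal (bN j)] => //.
by apply/mnmP => j; rewrite mnmE ffunE.
Qed.

Lemma max_mediated_mediated (R : realType) n m (a : 'I_m -> 'rV[R]_n) :
  (forall i, Zlattice (a i)) -> mediated a (max_mediated a).
Proof.
move=> aZ; have aC i : conv a (a i).
  exists (fun j => (j == i)%:R); split=> [j||]; first by rewrite ler0n.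
    by rewrite (bigD1 i) //= eqxx big1 ?addr0 // => j /negbTE ->.
  rewrite (bigD1 i) //= eqxx scale1r big1 ?addr0 // => j /negbTE ->.
  by rewrite scale0r.
have med0 : mediated a (range a).
  split=> [_ [i _ <-] | // | x ax]; last by right.
  by split; [exact: aC | exact: aZ].
split=> [x [L [sL _ _] Lx]|x ax|x [L [sL aL mL] Lx]]; first exact: sL.
- by exists (range a).
case: (mL _ Lx) => [[Zx [s [t [st [Ls es] [Lt et] xst]]]]|]; last by right.
have medL : mediated a L by [].
by left; split=> //; exists s, t; split=> //; split=> //; exists L.
Qed.

Lemma sub_max_mediated (R : realType) n m (a : 'I_m -> 'rV[R]_n) L :
  mediated a L -> L `<=` max_mediated a.
Proof. by move=> medL x Lx; exists L. Qed.

(* Main.v *)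
Require Import Defs.
From mathcomp Require Import all_boot all_order all_algebra.
From mathcomp Require Import mpoly finmap boolp classical_sets cardinality reals.

Set Implicit Arguments.
Unset Strict Implicit.
Unset Printing Implicit Defensive.

Import Order.TTheory GRing.Theory Num.Theory.

Local Open Scope ring_scope.

(** Write P for the half simplex and B for its lattice points.  Let x be a
    lattice point of the simplex 2P.  By 2-normality x = b0 + b1 with b0, b1 in
    B, so x is the midpoint of the even points 2b0 and 2b1 of the simplex.  This
    settles the case where x has such a decomposition with b0 <> b1.

    The remaining case is x = 2b, where b is not the midpoint of two distinct
    points of B; one has to show that b is a vertex of P.  The barycentric
    coordinates of x are rational ([barycentric_common_denominator]), so
    d b = sum_v w_v a_v, where the a_v are the vertices of P, the w_v are natural
    numbers and d = sum_v w_v > 0.  Hence the binomial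
    prod_v x_(a_v)^(w_v) - x_b^d lies in the toric ideal.

    The generators of degree two now come in through an evaluation: let e be the
    point with coordinate 1 at b and 0 elsewhere.  At e a quadratic form takes
    the value of its coefficient at x_b^2.  The monomial x_b^2 is alone in its
    toric fibre, because b is not a midpoint, so this coefficient is 0 for every
    quadric of the toric ideal ([quadric_vanishes]).  If the quadrics generate,
    the whole toric ideal vanishes at e.  The monomial x_b^d has the value 1 at e,
    so prod_v x_(a_v)^(w_v) does not vanish there, which means that w_v > 0 only
    if a_v = b ([midpoint_free_extremal]).  As d > 0, some a_v equals b. *)

(** * Monomials at a coordinate point *)

Section MonomialsAtACoordinatePoint.
Variables (K : comNzRingType) (N : nat).
Implicit Types (m : 'X_{1..N}) (i j : 'I_N).

Definition coordinate_point i : 'I_N -> K := fun j => (j == i)%:R.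

Lemma mevalX_coordinate_point i m :
  'X_[m].@[coordinate_point i] = (m == (U_(i) *+ mdeg m)%MM)%:R.
Proof.
rewrite mevalX; have [->|mi] := eqVneq m _.
  rewrite big1 // => j _; rewrite mulmnE mnm1E /coordinate_point eq_sym.
  by case: eqP => _; rewrite ?expr1n // mul0n expr0.
have [j ji mj] : exists2 j, j != i & (0 < m j)%N.
  apply/exists_inP; apply: contraNT mi => /exists_inPn m0.
  apply/eqP/mnmP => j; rewrite mulmnE mnm1E mdegE (bigD1 i) //= big1 ?addn0.
    have [<-|ij] := eqVneq; first by rewrite mul1n.
    have := m0 j; rewrite unfold_in /= eq_sym ij lt0n negbK mul0n.
    by move=> /(_ isT)/eqP.
  by move=> l /m0; rewrite lt0n negbK => /eqP.
by rewrite (bigD1 j) //= /coordinate_point (negbTE ji) expr0n gtn_eqF // mul0r.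
Qed.

Lemma mdeg2E m : mdeg m = 2%N -> exists i j, m = (U_(i) + U_(j))%MM.
Proof.
move=> m2; have [i mi] : exists i, (0 < m i)%N.
  apply/existsP; move: m2; apply: contra_eqT => /existsPn m0.
  by rewrite mdegE big1 // => i _; have := m0 i; rewrite lt0n negbK => /eqP.
have le : (U_(i) <= m)%MM.
  by apply/mnm_lepP => j; rewrite mnm1E; case: eqP => // <-.
have /mdeg1P[j /eqP mj] : mdeg (m - U_(i))%MM == 1%N.
  by rewrite -(eqn_add2r (mdeg (U_(i))%MM)) -mdegD submK // mdeg1 m2.
by exists i, j; rewrite -mj addmC submK.
Qed.

End MonomialsAtACoordinatePoint.

(** * Toric ideals *)

Section ToricIdeal.
Variables (k : fieldType) (n : nat) (B : {fset 'X_{1..n}}).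
Local Notation N := #|` B|.
Local Notation pt := (tnth (in_tuple B)).
Implicit Types (m : 'X_{1..N}) (i j l : 'I_N).

Definition moment m : 'X_{1..n} := (\sum_i pt i *+ m i)%MM.

(** The exponent vector of the image of the monomial [m] under the toric map: it
    records the degree of [m] at position 0 and the moment of [m] after that. *)
Definition toric_exponent m : 'X_{1..n.+1} :=
  (\sum_i (U_(ord0) + \sum_j U_(lift ord0 j) *+ pt i j) *+ m i)%MM.

Lemma toric_exponent0 m : toric_exponent m ord0 = mdeg m.
Proof.
rewrite mnm_sumE mdegE; apply: eq_bigr => i _.
rewrite mulmnE mnmDE mnm1E eqxx mnm_sumE big1 ?addn0 ?mul1n // => j _.
by rewrite mulmnE mnm1E eq_sym (negbTE (neq_lift _ _)).
Qed.

Lemma toric_exponent_lift m (j : 'I_n) :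
  toric_exponent m (lift ord0 j) = moment m j.
Proof.
rewrite !mnm_sumE; apply: eq_bigr => i _.
rewrite !mulmnE mnmDE mnm1E (negbTE (neq_lift _ _)) add0n; congr muln.
rewrite mnm_sumE (bigD1 j) //= big1 ?addn0; last first.
  by move=> l lj; rewrite mulmnE mnm1E (inj_eq lift_inj) (negbTE lj).
by rewrite mulmnE mnm1E eqxx mul1n.
Qed.

Lemma toric_exponentP m m' :
  toric_exponent m = toric_exponent m' <->
  mdeg m = mdeg m' /\ moment m = moment m'.
Proof.
split=> [E|[Ed Em]].
  split; first by rewrite -!toric_exponent0 E.
  by apply/mnmP => j; rewrite -!toric_exponent_lift E.
apply/mnmP => j; case: (unliftP ord0 j) => [j' ->|->].
  by rewrite !toric_exponent_lift Em.
by rewrite !toric_exponent0 Ed.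
Qed.

Lemma momentD m m' : moment (m + m')%MM = (moment m + moment m')%MM.
Proof.
apply/mnmP => j; rewrite mnmDE !mnm_sumE -big_split /=.
by apply: eq_bigr => i _; rewrite !mulmnE mnmDE mulnDr.
Qed.

Lemma momentMn m r : moment (m *+ r)%MM = (moment m *+ r)%MM.
Proof.
apply/mnmP => j; rewrite mulmnE !mnm_sumE big_distrl /=.
by apply: eq_bigr => i _; rewrite !mulmnE mulnA.
Qed.

Lemma moment_sum (I : Type) (s : seq I) (F : I -> 'X_{1..N}) :
  moment (\sum_(x <- s) F x)%MM = (\sum_(x <- s) moment (F x))%MM.
Proof.
elim: s => [|x s IH]; last by rewrite !big_cons momentD IH.
rewrite !big_nil /moment big1 // => i _; apply/mnmP => j.
by rewrite mulmnE !mnm0E muln0.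
Qed.

Lemma moment1 i : moment U_(i)%MM = pt i.
Proof.
rewrite /moment (bigD1 i) //= big1.
  by rewrite mnm1E eqxx mulm1n addm0.
by move=> j ji; rewrite mnm1E eq_sym (negbTE ji) mulm0n.
Qed.

Lemma toric_mapE (f : {mpoly k[N]}) :
  toric_map f = \sum_(m <- msupp f) f@_m *: 'X_[toric_exponent m].
Proof.
rewrite /toric_map /mmap; apply: eq_bigr => m _; rewrite mul_mpolyC.
congr (_ *: _); rewrite /mmap1 -mprodXnE; apply: eq_bigr => i _.
by rewrite /toric_monomial mpolyXD -mprodXnE.
Qed.

Lemma toric_mapB : {morph @toric_map k n B : f g / f - g}.
Proof. by move=> f g; rewrite /toric_map raddfB. Qed.

Lemma binomial_in_toric_ideal m m' :
  mdeg m = mdeg m' -> moment m = moment m' ->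
  toric_ideal ('X_[m] - 'X_[m'] : {mpoly k[N]}).
Proof.
move=> Ed Em; rewrite /toric_ideal /= toric_mapB !toric_mapE !msuppX.
rewrite !big_seq1 !mcoeffX !eqxx !scale1r.
rewrite (_ : toric_exponent m = toric_exponent m') ?subrr //.
by apply/toric_exponentP.
Qed.

(** Since [j = i] forces [l = i], this says that [pt i] is not the midpoint of two
    distinct points of [B]. *)
Definition midpoint_free i := forall j l, (pt j + pt l = pt i + pt i)%MM -> j = i.

(** The value of a quadric [f] at the [i]-th coordinate point is its coefficient
    at the square of the variable [i].  No other monomial of degree two has the
    same toric exponent as that square, so this coefficient is also a
    coefficient of [toric_map f], which is 0. *)
Lemma quadric_vanishes i (f : {mpoly k[N]}) :
  midpoint_free i -> toric_ideal_part 2 f -> f.@[coordinate_point k i] = 0.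
Proof.
move=> free [f0 fhom].
transitivity ((toric_map f)@_(toric_exponent (U_(i) *+ 2)%MM)); last first.
  by rewrite f0 mcoeff0.
rewrite toric_mapE raddf_sum /= mevalE !big_seq; apply: eq_bigr => m mf.
have m2 : mdeg m = 2%N by move/dhomogP: fhom; apply.
rewrite mcoeffZ mcoeffX -mevalX mevalX_coordinate_point m2.
congr (_ * (nat_of_bool _)%:R); apply/eqP/eqP => [-> //|/toric_exponentP[_]].
have [j [l ->]] := mdeg2E m2.
rewrite momentD momentMn !moment1 mulmS mulm1n => E.
by rewrite (free _ _ E) (free l j) ?[RHS]mulmS ?mulm1n // addmC; exact: E.
Qed.

(** The condition on the moment puts the binomial X^m - X_i^(mdeg m) in the toric
    ideal.  Every element of this ideal vanishes at the [i]-th coordinate point,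
    because the quadrics that generate it do.  There X_i^(mdeg m) takes the value 1, so X^m cannot take the value 0. *)
Lemma midpoint_free_extremal i m :
  generated_in_degree k B 2 -> midpoint_free i ->
  moment m = (pt i *+ mdeg m)%MM -> m = (U_(i) *+ mdeg m)%MM.
Proof.
move=> gen free Em; apply/eqP.
have dU : mdeg (U_(i) *+ mdeg m)%MM = mdeg m by rewrite mdegMn mdeg1 mul1n.
have : toric_ideal ('X_[m] - 'X_[U_(i) *+ mdeg m] : {mpoly k[N]}).
  by apply: binomial_in_toric_ideal; rewrite ?dU // momentMn moment1.
rewrite gen => -[s [quad E]].
have : ('X_[m] - 'X_[U_(i) *+ mdeg m]).@[coordinate_point k i] = 0.
  rewrite E raddf_sum /= big_seq big1 // => gh /quad /(quadric_vanishes free) h0.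
  by rewrite mevalM h0 mulr0.
rewrite mevalB !mevalX_coordinate_point dU eqxx.
by case: eqP => // _ /eqP; rewrite sub0r oppr_eq0 oner_eq0.
Qed.

End ToricIdeal.

(** * Barycentric coordinates of lattice points *)

Section Simplex.
Variables (R : realType) (n : nat).

(** Cramer's rule: the coordinates [c] solve an integral linear system whose
    matrix [A] has the rows (1, p i) and is invertible by affine independence,
    so that |det A| is a common denominator. *)
Lemma barycentric_common_denominator (p : 'I_n.+1 -> 'rV[R]_n)
    (c : 'I_n.+1 -> R) :
  affinely_independent p -> (forall i, Zlattice (p i)) ->
  (forall i, 0 <= c i) -> \sum_i c i = 1 -> Zlattice (\sum_i c i *: p i) ->
  exists d (w : 'I_n.+1 -> nat), (0 < d)%N /\ forall i, d%:R * c i = (w i)%:R.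
Proof.
move=> indep pZ c0 c1 xZ.
have /choice[P pP] :
    forall i, exists z : 'I_n -> int, forall j, p i 0 j = (z j)%:~R.
  by move=> i; have [z zE] := choice (pZ i); exists z.
have /choice[z zE] := xZ.
pose A : 'M[int]_(1 + n) := row_mx (const_mx 1) (\matrix_(i, j) P i j).
pose x : 'rV[int]_(1 + n) := row_mx (const_mx 1) (\row_j z j).
have mulA (v : 'rV[R]_(1 + n)) : v *m map_mx intr A =
    row_mx (const_mx (\sum_i v 0 i)) (\sum_i v 0 i *: p i).
  rewrite map_row_mx mul_mx_row; congr row_mx; apply/rowP => j.
    by rewrite !mxE; apply: eq_bigr => i _; rewrite !mxE mulr1.
  by rewrite mxE summxE; apply: eq_bigr => i _; rewrite !mxE pP.
have detA : \det A != 0.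
  rewrite -(intr_eq0 R) -det_map_mx; apply/det0P => -[v v0].
  rewrite mulA -[RHS]row_mx0 => /eq_row_mx[/rowP/(_ 0) + /rowP E].
  rewrite !mxE => /indep v_eq0; case/eqP: v0; apply/rowP => i; rewrite mxE.
  by apply: v_eq0; apply/rowP => j; rewrite E.
pose cv : 'rV[R]_(1 + n) := \row_i c i.
have cA : cv *m map_mx intr A = map_mx intr x.
  rewrite mulA map_row_mx; congr row_mx.
    by apply/rowP=> j; rewrite !mxE -[RHS]c1; apply: eq_bigr => i _; rewrite mxE.
  apply/rowP=> j; rewrite !mxE -zE !summxE; apply: eq_bigr => i _.
  by rewrite !mxE.
have cramer i : (\det A)%:~R * c i = ((x *m \adj A) 0 i)%:~R.
  have /rowP/(_ i) := congr1 (mulmx^~ (\adj (map_mx intr A))) cA.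
  rewrite -mulmxA mul_mx_adj mul_mx_scalar -map_mx_adj -map_mxM det_map_mx.
  by rewrite !mxE.
exists `|\det A|%N, (fun i => absz ((x *m \adj A) 0 i)).
split=> [|i]; first by rewrite absz_gt0.
by rewrite !natr_absz !intr_norm -cramer normrM (ger0_norm (c0 i)).
Qed.

End Simplex.

(** * Lattice points and exponent vectors *)

Section LatticePoints.
Variables (R : realType) (n : nat).
Implicit Types (a b : 'X_{1..n}).
Local Notation ep := (@exponent_point R n).

Lemma exponent_point_inj : injective ep.
Proof.
move=> a b /rowP E; apply/mnmP => j; have := E j; rewrite !mxE => /eqP.
by rewrite eqr_nat => /eqP.
Qed.

Lemma exponent_pointD a b : ep (a + b)%MM = ep a + ep b.
Proof. by apply/rowP => j; rewrite !mxE mnmDE natrD. Qed.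

Lemma exponent_pointMn a r : ep (a *+ r)%MM = r%:R *: ep a.
Proof. by apply/rowP => j; rewrite !mxE mulmnE natrM mulrC. Qed.

Lemma exponent_point_sum (I : finType) (F : I -> 'X_{1..n}) :
  ep (\sum_i F i)%MM = \sum_i ep (F i).
Proof.
apply/rowP => j; rewrite summxE mxE mnm_sumE natr_sum.
by apply: eq_bigr => i _; rewrite mxE.
Qed.

Lemma Zlattice_exponent_point a : Zlattice (ep a).
Proof. by move=> j; exists (a j)%:Z; rewrite mxE. Qed.

Lemma even_exponent_point a : even_lattice (2 *: ep a).
Proof. by move=> j; exists (a j)%:Z; rewrite !mxE intrM. Qed.

Lemma nonneg_Zlattice x :
  Zlattice x -> (forall j, 0 <= x 0 j) -> exists b, x = ep b.
Proof.
move=> xZ x0; have /choice[z zE] := xZ.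
exists [multinom `|z j|%N | j < n]; apply/rowP => j.
by rewrite !mxE mnmE natr_absz intr_norm -zE ger0_norm.
Qed.

Lemma conv_vertex m (p : 'I_m -> 'rV[R]_n) i : conv p (p i).
Proof.
exists (fun j => (j == i)%:R); split=> [j||]; first by rewrite ler0n.
  by rewrite (bigD1 i) //= eqxx big1 ?addr0 // => j /negbTE ->.
rewrite (bigD1 i) //= eqxx scale1r big1 ?addr0 // => j /negbTE ->.
by rewrite scale0r.
Qed.

End LatticePoints.

(** * Half simplices with a quadratic toric ideal *)

Theorem theorem5p9 (R : realType) (k : fieldType) (n : nat)
  (alpha : 'I_n.+1 -> 'rV[R]_n)
  (alpha_even : forall i j, exists a : nat, alpha i 0 j = (2 * a)%:R)
  (alpha_simplex : affinely_independent alpha)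
  (IB_quadratic :
     generated_in_degree k (nat_points (dilate 2^-1 (conv alpha))) 2)
  (half_2normal : normal_polytope 2 (dilate 2^-1 (conv alpha))) :
  H_simplex alpha.
Proof.
have two_neq0 : (2 : R) != 0 by rewrite pnatr_eq0.
have /choice[a aE] : forall i, exists b, alpha i = 2 *: exponent_point R b.
  move=> i; have /choice[z zE] := alpha_even i.
  exists [multinom z j | j < n]; apply/rowP => j.
  by rewrite !mxE mnmE zE natrM.
have aZ i : Zlattice (alpha i).
  by move=> j; exists (2 * (a i j))%N; rewrite aE !mxE -natrM.
set P := dilate 2^-1 (conv alpha) in IB_quadratic half_2normal.
have PE y : P y <-> conv alpha (2 *: y).
  split=> [[z az <-]|ay]; first by rewrite scalerA divff // scale1r.
  by exists (2 *: y) => //; rewrite scalerA mulVf // scale1r.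
set B := nat_points P in IB_quadratic.
have inB b : (b \in B) <-> P (exponent_point R b).
  rewrite /B /nat_points in_fset_set; last exact: nat_points_finite.
  by rewrite inE.
have PZ y : P y -> Zlattice y -> exists2 b, b \in B & y = exponent_point R b.
  move=> Py yZ; have [j|b yE] := nonneg_Zlattice yZ.
    case: Py => z [c [c0 _ ->]] <-; rewrite mxE summxE mulr_ge0 ?invr_ge0 //.
    by apply: sumr_ge0 => i _; rewrite aE !mxE !mulr_ge0.
  by exists b => //; apply/inB; rewrite -yE.
have mid b0 b1 : b0 \in B -> b1 \in B -> b0 != b1 ->
    midpoints (conv alpha `&` @Zlattice R n)
      (exponent_point R b0 + exponent_point R b1).
  move=> /inB/PE B0 /inB/PE B1 b01; split.
    by rewrite -exponent_pointD; exact: Zlattice_exponent_point.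
  exists (2 *: exponent_point R b0), (2 *: exponent_point R b1).
  have evenZ b : even_lattice (2 *: exponent_point R b) /\
                 Zlattice (2 *: exponent_point R b).
    split; first exact: even_exponent_point.
    by rewrite -exponent_pointMn; exact: Zlattice_exponent_point.
  have [[E0 Z0] [E1 Z1]] := (evenZ _ b0, evenZ _ b1).
  split=> //.
    by rewrite (inj_eq (scalerI two_neq0)) (inj_eq (@exponent_point_inj _ _)).
  by rewrite -scalerDr scalerA mulVf // scale1r.
(* The maximal mediated set fills the simplex once all the lattice points of the
   simplex form a mediated set. *)
apply/seteqP; split=> [x [L [sL _ _] Lx]|]; first exact: sL.
apply: sub_max_mediated; split=> // [_ [i _ <-]|x [xconv xZ]].
  by split; [exact: conv_vertex | exact: aZ].
have [|y yPZ xE] := half_2normal x.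
  by split=> //; exists (2^-1 *: x); [exists x | rewrite scalerA divff ?scale1r].
move: xE; rewrite big_ord_recl big_ord1.
have [Py0 Zy0] := yPZ ord0; have [Py1 Zy1] := yPZ (lift ord0 ord0).
have [b0 B0 ->] := PZ _ Py0 Zy0; have [b1 B1 ->] := PZ _ Py1 Zy1.
have [<-{b1 B1}|b01 ->] := eqVneq b0 b1; last by left; exact: mid.
move=> xE.
have /tnthP/=[i iE] : b0 \in in_tuple B by [].
have ptB j : tnth (in_tuple B) j \in B by exact: mem_tnth.
have [free|] := pselect (midpoint_free i); last first.
  (* Here b0 is the midpoint of two distinct points of B after all. *)
  move=> /existsNP[j /existsNP[l /not_implyP[E ji]]].
  left; rewrite xE iE -exponent_pointD -E exponent_pointD.
  apply: mid => //; apply: contra_not_neq ji => jl.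
  apply/(tuple_uniqP (in_tuple B) (fset_uniq B)).
  move: E; rewrite -jl => /mnmP E; apply/mnmP => h; have := E h.
  by rewrite !mnmDE !addnn => /double_inj.
right.
have [c [c0 c1 xc]] := xconv.
have [|d [w [d0 wE]]] := barycentric_common_denominator alpha_simplex aZ c0 c1.
  by rewrite -xc.
have /choice[idx idxE] : forall v, exists j, tnth (in_tuple B) j = a v.
  move=> v; have /tnthP[j ->] : a v \in in_tuple B; last by exists j.
  by apply/inB/PE; rewrite -aE; exact: conv_vertex.
(* d x is the sum of the w v alpha v, so b0 is the barycentre of the vertices
   a v with weights w v. *)
pose m := (\sum_v U_(idx v) *+ w v)%MM.
have md : mdeg m = d.
  have dE : d%:R = \sum_v (w v)%:R :> R.
    by rewrite -(eq_bigr _ (fun v _ => wE v)) -mulr_sumr c1 mulr1.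
  apply/eqP; rewrite -(eqr_nat R) dE mdeg_sum natr_sum.
  by apply/eqP/eq_bigr => v _; rewrite mdegMn mdeg1 mul1n.
have mm : moment m = (tnth (in_tuple B) i *+ mdeg m)%MM.
  apply: (@exponent_point_inj R); rewrite -iE md exponent_pointMn.
  apply: (scalerI two_neq0).
  rewrite scalerA [2 * _]mulrC -scalerA [2 *: _](scalerDl _ 1 1) scale1r -xE.
  rewrite xc scaler_sumr moment_sum exponent_point_sum scaler_sumr.
  apply: eq_bigr => v _; rewrite momentMn moment1 idxE exponent_pointMn.
  by rewrite !scalerA -wE aE !scalerA mulrC.
have mU := midpoint_free_extremal IB_quadratic free mm.
have [v wv] : exists v, (0 < w v)%N.
  apply/existsP; apply: contraTT d0 => /existsPn w0.
  rewrite -md mdeg_sum big1 // => v _; rewrite mdegMn.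
  by have := w0 v; rewrite lt0n negbK => /eqP ->; rewrite muln0.
have : (0 < m (idx v))%N.
  by rewrite mnm_sumE (bigD1 v) //= mulmnE mnm1E eqxx mul1n addn_gt0 wv.
rewrite mU mulmnE mnm1E; have [iv _|_] := eqVneq i (idx v); last by rewrite mul0n.
exists v => //; rewrite aE -idxE -iv -iE xE.
by rewrite (scalerDl _ 1 1) scale1r.
Qed.
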